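(* Fix $\varepsilon>0$. Let $N\ge1$ and $p\in(0,1/2]$ (both may depend on $n$). Let $(\eta^{(ij)}_\ell)_{1\le i\le j\le n,\,1\le\ell\le N}$ be i.i.d. sparse Rademacher$(p)$ random variables, i.e. with distribution $p\,\delta_{-1}+(1-2p)\,\delta_0+p\,\delta_1$. Define symmetric $n\times n$ matrices $Q_\ell$, $\ell=1,\dots,N$, by setting, for $1\le i\le j\le n$, $$(Q_\ell)_{ji}=(Q_\ell)_{ij}=\frac{\eta^{(ij)}_\ell}{\sqrt{2Np}} .$$ (a) Suppose that $p\to0$ and $np=\Omega(1)$ as $n\to\infty$. There is a constant $C>0$ such that if $N\ge C n^{2+2\varepsilon}\log n$, then with probability at least $1-O(n^{-2})$ the matrices $Q_\ell$ satisfy $$\sup_{1\le i\le j\le n}\Big|\sum_{\ell=1}^N (Q_\ell)_{ij}^2-1\Big|=O\Big(\frac{1}{(\log n)^2}\Big)\quad\text{and}\quad \sup_{(i,j)\ne(i',j')}\Big|\sum_{\ell=1}^N (Q_\ell)_{ij}(Q_\ell)_{i'j'}\Big|=O\Big(\frac{1}{n^{1+\varepsilon}}\Big),$$ where the second supremum is over pairs with $i\le j$, $i'\le j'$. (b) There exist constants $C_0\ge1$, $C_1>0$ such that if $p\ll\frac{1}{(\log n)^4}$, $np\ge C_0\log n$ and $N\ge C_1n^{2+2\varepsilon}\log n$, then with probability at least $1-O(n^{-2})$ the matrices $Q_\ell$ satisfy $$\max_{1\le\ell\le N}\|Q_\ell\|_{\mathrm{op}}=o\Big(\frac{\sqrt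 n}{(\log n)^2}\Big).$$
   Context: All asymptotics are as $n\to\infty$; $a_n\ll b_n$ means $a_n/b_n\to0$, and $a_n=\Omega(1)$ means $a_n$ is bounded below by a positive constant. $\|\cdot\|_{\mathrm{op}}$ is the operator norm. A statement that with probability at least $1-O(n^{-2})$ a random quantity is $O(a_n)$ (resp. $o(a_n)$) means that there is a deterministic sequence $b_n=O(a_n)$ (resp. $b_n=o(a_n)$) such that the quantity is at most $b_n$ with probability at least $1-O(n^{-2})$. *)

(* Defs.v *)
From HB Require Import structures.
From mathcomp Require Import all_boot all_order all_algebra.
From mathcomp Require Import finmap.
From mathcomp Require Import all_classical all_reals all_analysis.

Set Implicit Arguments.
Unset Strict Implicit.
Unset Printing Implicit Defensive.
Import Order.TTheory GRing.Theory Num.Theory.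
Import numFieldNormedType.Exports.
Local Open Scope classical_set_scope.
Local Open Scope ring_scope.

Definition sparse_rademacher {R : realType} (p : R) (A : set R) : \bar R :=
  (p%:E * \d_((-1)%R : R) A + (1 - 2 * p)%:E * \d_(0%R : R) A
   + p%:E * \d_(1%R : R) A)%E.

(* Mutual independence of the subfamily (X i), i in D: the product rule over
   every finite set of indices in D. *)
Definition mutually_independent {R : realType} {d : measure_display}
    {T : measurableType d} (P : probability T R) {I : choiceType}
    (D : set I) (X : I -> {RV P >-> R}) : Prop :=
  forall (J : {fset I}) (B : I -> set R),
    [set` J] `<=` D -> (forall i, measurable (B i)) ->
    P (\bigcap_(i in [set` J]) (X i @^-1` B i)) =
    (\prod_(i <- J) P (X i @^-1` B i))%E.

(* The variables are indexed by all triples (i, j, l), but only those with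
   i <= j are constrained, and only those enter the matrices below. *)
Definition iid_sparse_rademacher {R : realType} {d : measure_display}
    {T : measurableType d} (P : probability T R) (p : R) (n N : nat)
    (eta : 'I_n * 'I_n * 'I_N -> {RV P >-> R}) : Prop :=
  let D := [set x : 'I_n * 'I_n * 'I_N | (x.1.1 <= x.1.2)%N] in
  mutually_independent D eta /\
  (forall x, D x -> forall A : set R, measurable A ->
     distribution P (eta x) A = sparse_rademacher p A).

Definition Qmx {R : realType} (p : R) (n N : nat)
    (eta : 'I_n * 'I_n * 'I_N -> R) (l : 'I_N) : 'M[R]_n :=
  \matrix_(i, j)
    ((if (i <= j)%N then eta (i, j, l) else eta (j, i, l))
     / Num.sqrt (2 * N%:R * p)).

Definition l2norm {R : realType} (n : nat) (v : 'cV[R]_n) : R :=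
  Num.sqrt (\sum_i v i 0 ^+ 2).

Definition opnorm {R : realType} (n : nat) (M : 'M[R]_n) : R :=
  sup [set l2norm (M *m v) | v in [set v : 'cV[R]_n | l2norm v <= 1]].

(* The suprema below range over finite sets of nonnegative numbers, so 0 is a
   neutral default (and the value over an empty index set). *)
Definition diag_dev {R : realType} (n N : nat) (Q : 'I_N -> 'M[R]_n) : R :=
  \big[Num.max/0]_(x : 'I_n * 'I_n | (x.1 <= x.2)%N)
     `|\sum_(l < N) Q l x.1 x.2 ^+ 2 - 1|.

Definition offdiag_dev {R : realType} (n N : nat) (Q : 'I_N -> 'M[R]_n) : R :=
  \big[Num.max/0]_(xy : ('I_n * 'I_n) * ('I_n * 'I_n) |
        [&& (xy.1.1 <= xy.1.2)%N, (xy.2.1 <= xy.2.2)%N & xy.1 != xy.2])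
     `|\sum_(l < N) Q l xy.1.1 xy.1.2 * Q l xy.2.1 xy.2.2|.

Definition max_opnorm {R : realType} (n N : nat) (Q : 'I_N -> 'M[R]_n) : R :=
  \big[Num.max/0]_(l < N) opnorm (Q l).

(* E n holds with probability at least 1 - O(n^-2). *)
Definition whp {R : realType} (d : nat -> measure_display)
    (T : forall n, measurableType (d n)) (P : forall n, probability (T n) R)
    (E : forall n, set (T n)) : Prop :=
  exists2 e : nat -> R, e =O_\oo (fun n => (n%:R : R) ^- 2) &
    forall n, ((1 - e n)%:E <= P n (E n))%E.

(* Main.v *)
(* Part (a) is a Chernoff bound followed by a union bound over at most n^2, resp.
   n^4, index choices: e^x <= 1 + x + 2x^2 on [-1/2, 1/2] gives the tails
   2 exp(- N p b^2 / 4) for the squares and 2 exp(- N b^2 / 8) for the products,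
   and b = 1 / (ln n)^2, resp. b = n^-(1 + eps), makes these at most 2 n^-4,
   resp. 2 n^-6.
   Part (b) needs no concentration: almost surely the entries are at most
   (2Np)^(-1/2), so the operator norm is at most n (2Np)^(-1/2), and
   Np >= n^(1 + 2 eps) (ln n)^2 makes this O(n^(1/2 - eps) / ln n). *)

Require Import Defs.
From HB Require Import structures.
From mathcomp Require Import all_boot all_order all_algebra.
From mathcomp Require Import finmap.
From mathcomp Require Import all_classical all_reals all_analysis.
From mathcomp Require Import measurable_realfun.
From mathcomp Require Import ring lra.

Set Implicit Arguments.
Unset Strict Implicit.
Unset Printing Implicit Defensive.
Import Order.TTheory GRing.Theory Num.Theory.
Import numFieldNormedType.Exports.
Local Open Scope classical_set_scope.
Local Open Scope ring_scope.

(** * The operator norm: entrywise bound and homogeneous characterisation *)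

Section OperatorNorm.
Context {R : realType} {n : nat}.
Implicit Types (M : 'M[R]_n) (v : 'cV[R]_n).

(** Cauchy-Schwarz bounds each squared coordinate of [M *m v] by [m ^+ 2 * n%:R] times the squared
    norm of [v]; summing over the [n] rows adds the second factor [n]. *)
Lemma l2norm_mulmx_le_entries M v (m : R) : 0 <= m ->
  (forall i j, `|M i j| <= m) -> l2norm (M *m v) <= n%:R * m * l2norm v.
Proof.
move=> m0 Mm; rewrite -(ler_sqr (sqrtr_ge0 _)); last first.
  by rewrite nnegrE !mulr_ge0 // sqrtr_ge0.
rewrite exprMn !sqr_sqrtr; [|by apply: sumr_ge0 => i _; exact: sqr_ge0..].
have row_le i : (M *m v) i 0 ^+ 2 <= m ^+ 2 * n%:R * \sum_j v j 0 ^+ 2.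
  rewrite -mulrA -real_normK ?num_real//.
  (* Symmetrised as a double sum, the bound can be compared termwise with the expanded square of a
     row sum, which leaves only [2xy <= x^2 + y^2]. *)
  have -> : m ^+ 2 * (n%:R * \sum_j v j 0 ^+ 2) =
      \sum_j \sum_k m ^+ 2 * ((v j 0 ^+ 2 + v k 0 ^+ 2) / 2).
    under [RHS]eq_bigr do
      rewrite -mulr_sumr -mulr_suml big_split /= sumr_const card_ord.
    rewrite -mulr_sumr -mulr_suml big_split /= sumr_const card_ord.
    by rewrite sumrMnl -mulr_natl; field.
  have : `|(M *m v) i 0| <= \sum_j m * `|v j 0|.
    rewrite mxE (le_trans (ler_norm_sum _ _ _))// ler_sum// => j _.
    by rewrite normrM ler_wpM2r.
  rewrite -ler_sqr ?nnegrE ?sumr_ge0// => [/le_trans|]; last first.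
    by move=> j _; rewrite mulr_ge0.
  apply; rewrite expr2 mulr_suml ler_sum// => j _.
  rewrite mulr_sumr ler_sum// => k _.
  rewrite -(@real_normK _ (v j 0)) ?num_real// -(@real_normK _ (v k 0)) ?num_real//.
  have := sqr_ge0 (m * `|v j 0| - m * `|v k 0|).
  move: `|_| `|_| => x y; nra.
apply: (le_trans (ler_sum _ (fun i _ => row_le i))).
rewrite sumr_const card_ord -[leLHS]mulr_natl.
by rewrite le_eqVlt; apply/orP; left; apply/eqP; ring.
Qed.

Lemma l2normZ (a : R) v : l2norm (a *: v) = `|a| * l2norm v.
Proof.
rewrite /l2norm -[in RHS]sqrtr_sqr -sqrtrM ?sqr_ge0// mulr_sumr.
by congr Num.sqrt; apply: eq_bigr => i _; rewrite mxE exprMn.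
Qed.

Lemma l2norm_le0 v : l2norm v <= 0 -> v = 0.
Proof.
rewrite le_eqVlt ltNge sqrtr_ge0 orbF sqrtr_eq0 => s0.
have /psumr_eq0P : \sum_i v i 0 ^+ 2 = 0.
  by apply/eqP; rewrite eq_le s0 sumr_ge0// => i _; exact: sqr_ge0.
move=> h; apply/matrixP => i j; rewrite ord1 mxE.
by apply/eqP; rewrite -sqrf_eq0 h// => k _; exact: sqr_ge0.
Qed.

(** Scaling a nonzero [v] to norm one turns the supremum over the unit ball into a homogeneous
    inequality. The entrywise bound shows that the set of values is bounded above, as [ub_le_sup]
    demands. *)
Lemma opnorm_leP M (b : R) : 0 <= b ->
  opnorm M <= b <-> forall v, l2norm (M *m v) <= b * l2norm v.
Proof.
move=> b0; split; last first.
  move=> h; apply: ge_sup; first (exists (l2norm (M *m 0)); exists 0 => //=).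
    by rewrite /l2norm big1 ?sqrtr0// => i _; rewrite mxE expr0n.
  by move=> _ [v /= v1 <-]; rewrite (le_trans (h v))// ler_piMr.
move=> Mb v.
have [/l2norm_le0 ->|v0] := leP (l2norm v) 0.
  by rewrite mulmx0 -(scale0r (0 : 'cV[R]_n)) l2normZ normr0 mul0r mulr0.
have -> : v = l2norm v *: ((l2norm v)^-1 *: v).
  by rewrite scalerA divff ?scale1r// gt_eqF.
rewrite -scalemxAr !l2normZ [leRHS]mulrCA.
rewrite ler_pM2l ?normr_gt0 ?gt_eqF//.
have u1 : `|(l2norm v)^-1| * l2norm v = 1.
  by rewrite gtr0_norm ?invr_gt0// mulVf// gt_eqF.
rewrite u1 mulr1 (le_trans _ Mb)//.
apply: ub_le_sup; last by exists ((l2norm v)^-1 *: v) => //=; rewrite l2normZ u1.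
pose m := \sum_i \sum_j `|M i j|.
have m0 : 0 <= m by apply: sumr_ge0 => i _; exact: sumr_ge0.
exists (n%:R * m) => _ [w /= w1 <-].
have Mm i j : `|M i j| <= m.
  rewrite /m (bigD1 i)//= (bigD1 j)//= -addrA lerDl addr_ge0//.
    exact: sumr_ge0.
  by apply: sumr_ge0 => k _; exact: sumr_ge0.
by rewrite (le_trans (l2norm_mulmx_le_entries w m0 Mm))// ler_piMr// mulr_ge0.
Qed.

End OperatorNorm.

(** * Measurability of upper bounds on the operator norm *)

Section OperatorNormMeasurable.
Context {R : realType} {n : nat}.

(* Countably many test vectors suffice for [opnorm M <= b], by homogeneity and
   density of the rationals; this is what makes that event measurable. *)
Definition intvec (z : {ffun 'I_n -> int}) : 'cV[R]_n := \col_i (z i)%:~R.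

Lemma opnorm_le_intP (M : 'M[R]_n) (b : R) : 0 <= b ->
  opnorm M <= b <->
  forall z, l2norm (M *m intvec z) <= b * l2norm (intvec z).
Proof.
move=> b0; split=> [/(opnorm_leP _ b0) h z|h]; first exact: h.
apply/(opnorm_leP _ b0) => v.
(* Rounding [k.+1%:R *: v] down and scaling back gives vectors within [k.+1%:R^-1] of [v] in each
   coordinate. Homogeneity carries the inequality from [intvec (zk k)] to [u k], and continuity of
   the norm carries it to [v]. *)
pose zk k := [ffun i => Num.floor (k.+1%:R * v i 0)] : {ffun 'I_n -> int}.
pose u k : 'cV[R]_n := k.+1%:R^-1 *: intvec (zk k).
have u_le k : l2norm (M *m u k) <= b * l2norm (u k).
  by rewrite -scalemxAr !l2normZ mulrCA ler_wpM2l.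
have u_cvg i : u k i 0 @[k --> \oo] --> v i 0.
  apply: (@squeeze_cvgr _ _ _ _ (fun k => v i 0 - k.+1%:R^-1) (fun=> v i 0)).
  - near=> k.
    have /andP[fl fg] := floor_itv (k.+1%:R * v i 0).
    rewrite !mxE ffunE; apply/andP; split.
      rewrite -(ler_pM2l (ltr0Sn R k)) mulrBr mulVKf ?pnatr_eq0// divff ?pnatr_eq0//.
      by rewrite lerBlDr -[in leRHS]intrD1 ltW.
    by rewrite -(ler_pM2l (ltr0Sn R k)) mulVKf ?pnatr_eq0.
  - rewrite -[X in _ --> X]subr0; apply: cvgB; first exact: cvg_cst.
    exact: cvg_harmonic.
  - exact: cvg_cst.
have add_cont : continuous (fun x : R * R => x.1 + x.2) by exact: add_continuous.
have norm_cvg (w : nat -> 'cV[R]_n) (w0 : 'cV[R]_n) :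
    (forall i, w k i 0 @[k --> \oo] --> w0 i 0) ->
    l2norm (w k) @[k --> \oo] --> l2norm w0.
  move=> wcvg; apply: (@cvg_comp _ _ _ (fun k => \sum_i w k i 0 ^+ 2) Num.sqrt).
    apply: (@cvg_big _ _ _ 0 xpredT add_cont) => i _.
    exact: (@cvgM _ _ _ _ _ _ _ _ (wcvg i) (wcvg i)).
  exact: sqrt_continuous.
apply: (ler_cvg_to (norm_cvg (fun k => M *m u k) _ _)
  (cvgM (cvg_cst b) (norm_cvg u v u_cvg))); last by near=> k; exact: u_le.
move=> i; rewrite mxE; under eq_fun do rewrite mxE.
apply: (@cvg_big _ _ _ 0 xpredT add_cont) => j _.
by apply: cvgM => //; exact: cvg_cst.
Unshelve. all: by end_near. Qed.

Lemma measurable_opnorm_le d (T : measurableType d) (M : T -> 'M[R]_n) (b : R) :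
  0 <= b -> (forall i j, measurable_fun setT (fun w => M w i j)) ->
  measurable [set w | opnorm (M w) <= b].
Proof.
move=> b0 mM.
(* A countable intersection over integer vectors, complemented so that closure under countable
   unions applies. *)
have -> : [set w | opnorm (M w) <= b] =
    ~` \bigcup_z ~` [set w | l2norm (M w *m intvec z) <= b * l2norm (intvec z)].
  rewrite setC_bigcup; under eq_bigcapr do rewrite setCK.
  apply/seteqP; split => w /=.
    by move/(opnorm_le_intP _ b0) => h z _; exact: h.
  by move=> h; apply/(opnorm_le_intP _ b0) => z; exact: h z I.
apply: measurableC; apply: countable_bigcupT_measurable => // z.
apply: measurableC; rewrite -[X in measurable X]setTI; apply: measurable_fun_le => //.
  apply: measurableT_comp; first exact: continuous_measurable_fun (@sqrt_continuous R).
  apply: measurable_sum => i; apply: measurable_funX.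
  under eq_fun do rewrite mxE.
  by apply: measurable_sum => j; apply: measurable_funM.
Qed.

End OperatorNormMeasurable.

(** * Chernoff bound for sums of independent finitely valued variables *)

Section ChernoffDiscrete.
Context {R : realType} {d : measure_display} {T : measurableType d}.
Variable P : probability T R.

Lemma probability_bigsetU_le (I : Type) (s : seq I) (Q : pred I)
    (F : I -> set T) : (forall i, measurable (F i)) ->
  (P (\big[setU/set0]_(i <- s | Q i) F i) <= \sum_(i <- s | Q i) P (F i))%E.
Proof.
move=> mF; elim: s => [|i s IH]; first by rewrite !big_nil measure0.
rewrite !big_cons; case: ifP => // _.
apply: (le_trans (measureU2 _ _ _)) => //; last exact: leeD2l.
exact: bigsetU_measurable.
Qed.

Lemma expR_abs_le (x y : R) : expR (`|x| - y) <= expR (x - y) + expR (- x - y).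
Proof.
by have [|] := ger0P x => _; rewrite ?lerDl ?lerDr expR_ge0.
Qed.

(** Here [A l v] stands for the event that the [l]-th summand has outcome [v], with mass [mu v] and
    value [f v]. Almost surely every summand has an outcome, so the tail is at most a finite sum
    over outcome sequences, and the exponential moments are finite sums instead of integrals. The
    signs [lam] and [- lam] account for the factor 2. *)
Lemma chernoff_discrete (V : finType) (N : nat) (A : 'I_N -> V -> set T)
    (mu f : V -> R) (S : T -> R) (lam c t : R) :
  (forall l v, measurable (A l v)) ->
  (forall l, P (~` \bigcup_v A l v) = 0)%E ->
  (forall v, 0 <= mu v) ->
  (forall a : 'I_N -> V, P (\bigcap_l A l (a l)) = (\prod_l mu (a l))%:E) ->
  measurable_fun setT S ->
  (forall w (a : 'I_N -> V), (forall l, A l (a l) w) -> S w = \sum_l f (a l)) ->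
  0 <= lam ->
  \sum_v mu v * expR (lam * f v) <= expR c ->
  \sum_v mu v * expR (- lam * f v) <= expR c ->
  (P [set w | t < `|S w|]%R <= (2 * expR (N%:R * c - lam * t))%R%:E)%E.
Proof.
move=> mA A0 mu0 PA mS SE lam0 mgf mgfN.
(* [G] is the null event that some summand has no listed outcome; [C a] is the event of the outcome
   sequence [a]. *)
pose G := \big[setU/set0]_(l < N) ~` \bigcup_v A l v.
pose C (a : {ffun 'I_N -> V}) := \bigcap_l A l (a l).
pose big (a : {ffun 'I_N -> V}) := t < `|\sum_l f (a l)|.
have mU l : measurable (\bigcup_v A l v).
  by apply: countable_bigcupT_measurable => //; exact: countableP.
have mC a : measurable (C a) by apply: fin_bigcap_measurable => //; exact: finite_finset.
have mG : measurable G by apply: bigsetU_measurable => l _; exact: measurableC.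
have mF : measurable (\big[setU/set0]_(a | big a) C a) by exact: bigsetU_measurable.
have mB : measurable [set w | t < `|S w|].
  rewrite (_ : mkset _ = ~` [set w | `|S w| <= t]); last first.
    by apply/seteqP; split => w /=; rewrite ltNge => /negP.
  apply: measurableC; rewrite -[X in measurable X]setTI.
  by apply: measurable_fun_le => //; exact: measurableT_comp.
have cover : [set w | t < `|S w|] `<=` G `|` \big[setU/set0]_(a | big a) C a.
  move=> w /= tS; have [Gw|Gw] := pselect (G w); [by left|right].
  have /choice[a Aa] l : exists v, A l v w.
    apply: contrapT => h; apply: Gw; rewrite /G -bigcup_seq.
    by exists l; rewrite /= ?mem_index_enum// => -[v _ Av]; apply: h; exists v.
  rewrite -bigcup_seq_cond; exists [ffun l => a l].
    rewrite /= mem_index_enum /big /=.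
    by under eq_bigr do rewrite ffunE; rewrite -(SE w).
  by move=> l _ /=; rewrite ffunE.
have PG : P G = 0%E.
  apply/eqP; rewrite eq_le measure_ge0 andbT.
  apply: (le_trans (probability_bigsetU_le _ _ _)) => [l|]; first exact: measurableC.
  by rewrite big1.
apply: (@le_trans _ _ (P (G `|` \big[setU/set0]_(a | big a) C a))).
  by apply: le_measure; rewrite ?inE//; exact: measurableU.
apply: (le_trans (measureU2 _ mG mF)); rewrite [X in (X + _)%E]PG add0e.
apply: (le_trans (probability_bigsetU_le _ _ _)) => //.
have -> : (\sum_(a | big a) P (C a) = (\sum_(a | big a) \prod_l mu (a l))%:E)%E.
  by rewrite -sumEFin; apply: eq_bigr => a _; exact: PA.
rewrite lee_fin.
(* Factorisation of the moment generating function: a sum of products over all sequences is the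
   product over [l] of one-variable sums, each at most [expR c]. *)
have tilt (s : R) : \sum_v mu v * expR (s * f v) <= expR c ->
    \sum_(a : {ffun 'I_N -> V}) (\prod_l mu (a l)) * expR (s * \sum_l f (a l))
    <= expR (N%:R * c).
  move=> hs; rewrite expRM_natl -[N in leRHS]card_ord -prodr_const.
  under [leLHS]eq_bigr do rewrite mulr_sumr expR_sum -big_split.
  rewrite -(bigA_distr_bigA (fun (_ : 'I_N) v => mu v * expR (s * f v))).
  apply: ler_prod => l _; rewrite hs andbT sumr_ge0// => v _.
  by rewrite mulr_ge0 ?expR_ge0.
(* Markov's inequality term by term: on [big a] the two exponentials, weighted by
   [expR (- (lam * t))], add up to at least 1, and the terms added for the other [a] are
   nonnegative. *)
apply: (@le_trans _ _ (\sum_(a : {ffun 'I_N -> V}) ((\prod_l mu (a l)) *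
    (expR (lam * \sum_l f (a l)) + expR (- lam * \sum_l f (a l)))
      * expR (- (lam * t))))); last first.
  rewrite -mulr_suml expRD mulrA ler_wpM2r ?expR_ge0//.
  under [leLHS]eq_bigr do rewrite mulrDr.
  by rewrite big_split /= mulr2n mulrDl mul1r lerD ?tilt.
rewrite big_mkcond ler_sum// => a _.
have mu_ge0 : 0 <= \prod_l mu (a l) by exact: prodr_ge0.
case: ifPn => [/ltW ta|_]; last by rewrite !mulr_ge0 ?addr_ge0 ?expR_ge0.
rewrite -mulrA ler_peMr// mulrDl -!expRD mulNr.
move: (expR_abs_le (lam * \sum_l f (a l)) (lam * t)); apply: le_trans.
rewrite -expR0 ler_expR subr_ge0 normrM (ger0_norm lam0).
exact: ler_wpM2l.
Qed.

End ChernoffDiscrete.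

(** * Exponential moments of the sparse Rademacher law *)

Section SparseRademacherMgf.
Context {R : realType}.
Implicit Types (p lam x : R) (v : 'I_3).

(* The atoms -1, 0, 1 of the distribution, indexed by 0, 1, 2. *)
Definition srval v : R := v%:R - 1.

Definition srmass p v : R := if v == 1 then 1 - 2 * p else p.

(** From [expR (- x) >= 1 - x] follows [expR x * (1 - x) <= 1], while [(1 - x) * (1 + x + 2 * x ^+
    2) = 1 + x ^+ 2 * (1 - 2 * x)] is at least 1 for [x <= 1 / 2]. *)
Lemma expR_le_quadratic x : `|x| <= 1 / 2 -> expR x <= 1 + x + 2 * x ^+ 2.
Proof.
rewrite ler_norml => /andP[x1 x2].
have := expR_ge1Dx (- x); rewrite expRN => h.
have e0 := expR_gt0 x.
have : expR x * (1 - x) <= 1.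
  by rewrite -[leRHS](mulfV (lt0r_neq0 e0)) ler_pM2l.
nra.
Qed.

Lemma sum_srval (F : R -> R) p :
  \sum_v srmass p v * F (srval v) = p * F (-1) + (1 - 2 * p) * F 0 + p * F 1.
Proof.
rewrite !big_ord_recl big_ord0 addr0 /srmass /srval /= addrA.
by rewrite sub0r subrr -[2%:R]natr1 addrK.
Qed.

Lemma srmass_ge0 p v : 0 < p <= 1 / 2 -> 0 <= srmass p v.
Proof. by move=> /andP[p0 p1]; rewrite /srmass; case: ifP => _; lra. Qed.

(** The square is Bernoulli with mean [2 * p], so its moment [1 + 2 * p * (expR lam - 1)] is at most
    [expR (2 * p * (lam + 2 * lam ^+ 2))]; centring cancels the linear term. *)
Lemma mgf_square p lam : 0 < p <= 1 / 2 -> `|lam| <= 1 / 2 ->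
  \sum_v srmass p v * expR (lam * (srval v ^+ 2 - 2 * p))
  <= expR (4 * p * lam ^+ 2).
Proof.
move=> /andP[p0 p1] lam1.
rewrite (sum_srval (fun x => expR (lam * (x ^+ 2 - 2 * p)))).
rewrite !expr2 mulr0 mulrNN mulr1 !mulrBr mulr1 !expRD mulr0 expR0.
have q := expR_le_quadratic lam1.
have -> : 4 * p * (lam * lam) =
    (2 * p * (lam + 2 * lam ^+ 2)) + - (lam * (2 * p)) by ring.
rewrite expRD !mulrA -!mulrDl ler_pM2r ?expR_gt0//.
by apply: le_trans (expR_ge1Dx _); nra.
Qed.

(** The product is 1 and -1 with mass [2 * p ^+ 2] each and 0 otherwise. By symmetry the linear
    terms of the quadratic bound cancel, leaving [1 + 8 * p ^+ 2 * lam ^+ 2]. *)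
Lemma mgf_product p lam : 0 < p <= 1 / 2 -> `|lam| <= 1 / 2 ->
  \sum_(v : 'I_3 * 'I_3) srmass p v.1 * srmass p v.2 *
    expR (lam * (srval v.1 * srval v.2))
  <= expR (8 * p ^+ 2 * lam ^+ 2).
Proof.
move=> /andP[p0 p1] lam1.
rewrite -(pair_bigA _ (fun u v => srmass p u * srmass p v *
  expR (lam * (srval u * srval v)))) /=.
under eq_bigr => u _.
  under eq_bigr do rewrite -mulrA.
  rewrite -mulr_sumr (sum_srval (fun x => expR (lam * (srval u * x)))).
  over.
rewrite (sum_srval (fun y : R => p * expR (lam * (y * -1)) +
  (1 - 2 * p) * expR (lam * (y * 0)) + p * expR (lam * (y * 1)))).
rewrite !(mulr0, mul0r, mulr1, mulrN, mulNr, opprK, expR0).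
have q := expR_le_quadratic lam1.
have := @expR_le_quadratic (- lam); rewrite normrN => /(_ lam1) q'.
apply: le_trans (expR_ge1Dx _).
rewrite sqrrN in q'; move: (expR lam) (expR (- lam)) q q' => a b q q'.
have : 0 <= p ^+ 2 * (4 * lam ^+ 2 + 2 - a - b).
  by rewrite mulr_ge0 ?sqr_ge0//; lra.
by move=> ?; nra.
Qed.

End SparseRademacherMgf.

(** * Finite-dimensional laws and tail bounds for the matrix entries *)

Section SparseRademacherLaw.
Context {R : realType} {d : measure_display} {T : measurableType d}.
Variables (P : probability T R) (p : R) (n N : nat).
Variable eta : 'I_n * 'I_n * 'I_N -> {RV P >-> R}.
Hypothesis iid : iid_sparse_rademacher p eta.

Lemma measurable_eta_preimage x (A : set R) :
  measurable A -> measurable (eta x @^-1` A).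
Proof. by move=> mA; rewrite -[X in measurable X]setTI; exact: measurable_funP. Qed.

Lemma eta_atom (x : 'I_n * 'I_n * 'I_N) v : (x.1.1 <= x.1.2)%N ->
  P (eta x @^-1` [set srval v]) = (srmass p v)%:E.
Proof.
move=> xD; rewrite -[LHS]/(distribution P (eta x) _) iid.2//.
have dE (a c : R) : \d_a [set c] = ((a == c)%:R)%:E.
  by rewrite diracE; congr ((nat_of_bool _)%:R%:E); apply/idP/eqP => [/set_mem//|->]; exact: mem_set.
rewrite /sparse_rademacher !dE -!EFinM -!EFinD; congr EFin.
have [e1 e2 e3] : [/\ (-1 == 0 :> R) = false, (-1 == 1 :> R) = false
    & (0 == 1 :> R) = false] by split; apply: lt_eqF; lra.
rewrite /srmass /srval; case: v => [[|[|[|//]]] ?] /=.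
- by rewrite sub0r eqxx ![_ == -1]eq_sym e1 e2 /= mulr1 !mulr0 !addr0.
- by rewrite subrr eqxx e1 [1 == 0]eq_sym e3 /= mulr1 !mulr0 addr0 add0r.
- by rewrite -[2%:R]natr1 addrK eqxx e2 e3 /= mulr1 !mulr0 !add0r.
Qed.

(** Each of the three Dirac masses vanishes off the atoms. This supplies the almost sure covering
    for the Chernoff bound and the almost sure entry bound for the operator norm. *)
Lemma eta_range (x : 'I_n * 'I_n * 'I_N) : (x.1.1 <= x.1.2)%N ->
  P (~` \bigcup_v (eta x @^-1` [set srval v])) = 0%E.
Proof.
move=> xD; set B := \bigcup_(v : 'I_3) [set (srval v : R)].
have mB : measurable B by apply: countable_bigcupT_measurable; first exact: countableP.
rewrite -preimage_bigcup preimage_setC -[LHS]/(distribution P (eta x) _) iid.2//; last first.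
  exact: measurableC.
have dB (a : R) (v : 'I_3) : a = srval v -> (\d_a (~` B) : \bar R) = 0%E.
  by move=> ->; rewrite diracE memNset// => /(_ (ex_intro2 _ _ v I erefl)).
rewrite /sparse_rademacher (dB (-1) ord0) ?(dB 0 1) ?(dB 1 ord_max) ?mule0 ?adde0//.
- by rewrite /srval -[2%:R]natr1 addrK.
- by rewrite /srval subrr.
- by rewrite /srval sub0r.
Qed.

(** The product rule on a duplicate-free list, applied below to all triples over one matrix
    position, or over two positions listed one after the other. *)
Lemma independent_seq (s : seq ('I_n * 'I_n * 'I_N)) 
    (v : 'I_n * 'I_n * 'I_N -> 'I_3) :
  uniq s -> {in s, forall x : 'I_n * 'I_n * 'I_N, (x.1.1 <= x.1.2)%N} ->
  P (\bigcap_(x in [set` s]) (eta x @^-1` [set srval (v x)])) =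
  (\prod_(x <- s) srmass p (v x))%:E.
Proof.
move=> us sD.
have sE : [set` [fset x | x in s]%fset] = [set` s].
  by apply/seteqP; split => x /=; rewrite in_fset.
have := iid.1 [fset x | x in s]%fset (fun x => [set srval (v x)]).
rewrite sE => ->//.
rewrite (perm_big s) /=; last first.
  by apply: uniq_perm; rewrite ?fset_uniq// => x; rewrite in_fset.
by rewrite -prodEFin; apply: eq_big_seq => x xs; rewrite eta_atom// sD.
Qed.

Hypotheses (p_bounds : 0 < p <= 1 / 2) (N_gt0 : (0 < N)%N).

Let Q l w := Qmx p (fun x => eta x w) l.

Lemma measurable_Qmx l i j : measurable_fun setT (fun w => Q l w i j).
Proof.
under eq_fun do rewrite mxE.
by case: (i <= j)%N; apply: measurable_funM.
Qed.

Let scale_gt0 : 0 < 2 * N%:R * p.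
Proof. by case/andP: p_bounds => p0 _; rewrite !mulr_gt0// ltr0n. Qed.

Lemma Qmx_mul l w (i j i' j' : 'I_n) : (i <= j)%N -> (i' <= j')%N ->
  Q l w i j * Q l w i' j' = eta (i, j, l) w * eta (i', j', l) w / (2 * N%:R * p).
Proof.
move=> ij ij'; rewrite !mxE ij ij' mulrACA -invfM -expr2 sqr_sqrtr//.
exact: ltW.
Qed.

(** The threshold for the unnormalised sum is [2 * N * p * b], so the exponent [4 * N * p * lam ^+ 2
    - 2 * N * p * b * lam] is least at [lam = b / 4]; [b <= 2] keeps [lam] at most [1 / 2]. *)
Lemma diag_tail (i j : 'I_n) (b : R) : (i <= j)%N -> 0 <= b <= 2 ->
  (P [set w | b < `|\sum_l Q l w i j ^+ 2 - 1|]%R <=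
   (2 * expR (- (N%:R * p * b ^+ 2 / 4)))%R%:E)%E.
Proof.
move=> ij /andP[b0 b2].
have SE w : \sum_l Q l w i j ^+ 2 - 1 =
    (\sum_l (eta (i, j, l) w ^+ 2 - 2 * p)) / (2 * N%:R * p).
  under eq_bigr do rewrite expr2 Qmx_mul//.
  rewrite -mulr_suml sumrB sumr_const card_ord -[2 * p *+ N]mulr_natl.
  by rewrite mulrBl [N%:R * _]mulrCA mulrA divff// gt_eqF.
rewrite (_ : mkset _ = [set w | b * (2 * N%:R * p) <
    `|\sum_l (eta (i, j, l) w ^+ 2 - 2 * p)|]); last first.
  apply/seteqP; split => w /=; rewrite SE normrM normfV (gtr0_norm scale_gt0);
    by rewrite ltr_pdivlMr.
have lam_norm : `|b / 4| <= 1 / 2 by rewrite ger0_norm; lra.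
apply: (le_trans (@chernoff_discrete _ _ _ P _ N
  (fun l v => eta (i, j, l) @^-1` [set srval v]) (srmass p)
  (fun v => srval v ^+ 2 - 2 * p) _ (b / 4) (4 * p * (b / 4) ^+ 2) _ _ _ _ _ _ _ _ _ _)).
- by move=> l v; exact: measurable_eta_preimage.
- by move=> l; exact: eta_range.
- by move=> v; exact: srmass_ge0.
- move=> a; have := @independent_seq [seq (i, j, l) | l <- enum 'I_N] (fun x => a x.2).
  rewrite big_map big_enum /= => <-; last 2 first.
    by rewrite map_inj_uniq ?enum_uniq// => ? ? [].
    by move=> _ /mapP[l _ ->].
  congr (P _); apply/seteqP; split => w /= h; last first.
    by move=> l _; apply: (h (i, j, l)); rewrite /= map_f ?mem_enum.
  by move=> _ /mapP[l _ ->]; exact: h.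
- apply: measurable_sum => l; apply: measurable_funB; last exact: measurable_cst.
  exact: measurable_funX.
- by move=> w a ha; apply: eq_bigr => l _; rewrite ha.
- lra.
- exact: mgf_square.
- by rewrite -[in leRHS](sqrrN (b / 4)); apply: mgf_square; rewrite ?normrN.
by rewrite lee_fin ler_pM2l// ler_expR le_eqVlt; apply/orP; left; apply/eqP; field.
Qed.

(** The exponent [8 * N * p ^+ 2 * lam ^+ 2 - 2 * N * p * b * lam] is least at [lam = b / (8 * p)];
    [b <= 4 * p] keeps [lam] at most [1 / 2]. Outcomes are pairs of atoms, one for each position. *)
Lemma offdiag_tail (x y : 'I_n * 'I_n) (b : R) :
  (x.1 <= x.2)%N -> (y.1 <= y.2)%N -> x != y -> 0 <= b <= 4 * p ->
  (P [set w | b < `|\sum_l Q l w x.1 x.2 * Q l w y.1 y.2|]%R <=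
   (2 * expR (- (N%:R * b ^+ 2 / 8)))%R%:E)%E.
Proof.
move: x y => [i j] [i' j'] /= ij ij' xy /andP[b0 b4].
have [p0 _] := andP p_bounds.
have SE w : \sum_l Q l w i j * Q l w i' j' =
    (\sum_l eta (i, j, l) w * eta (i', j', l) w) / (2 * N%:R * p).
  by under eq_bigr do rewrite Qmx_mul//; rewrite -mulr_suml.
rewrite (_ : mkset _ = [set w | b * (2 * N%:R * p) <
    `|\sum_l eta (i, j, l) w * eta (i', j', l) w|]); last first.
  apply/seteqP; split => w /=; rewrite SE normrM normfV (gtr0_norm scale_gt0);
    by rewrite ltr_pdivlMr.
have lam0 : 0 <= b / (8 * p) by rewrite divr_ge0// mulr_ge0// ltW.
have lam_norm : `|b / (8 * p)| <= 1 / 2.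
  by rewrite ger0_norm// ler_pdivrMr ?mulr_gt0//; lra.
apply: (le_trans (@chernoff_discrete _ _ _ P _ N
  (fun l v => eta (i, j, l) @^-1` [set srval v.1] `&`
              eta (i', j', l) @^-1` [set srval v.2])
  (fun v : 'I_3 * 'I_3 => srmass p v.1 * srmass p v.2)
  (fun v => srval v.1 * srval v.2) _
  (b / (8 * p)) (8 * p ^+ 2 * (b / (8 * p)) ^+ 2) _ _ _ _ _ _ _ _ _ _)).
- by move=> l v; apply: measurableI; exact: measurable_eta_preimage.
- move=> l.
  rewrite (_ : ~` _ = ~` (\bigcup_v (eta (i, j, l) @^-1` [set srval v])) `|`
      ~` (\bigcup_v (eta (i', j', l) @^-1` [set srval v]))); last first.
    rewrite -setCI; congr (~` _); apply/seteqP; split => w /=.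
      by move=> [[u v] _ [/= hu hv]]; split; [exists u|exists v].
    by move=> [[u _ hu] [v _ hv]]; exists (u, v).
  have mC i0 j0 : measurable (~` \bigcup_v (eta (i0, j0, l) @^-1` [set srval v])).
    apply: measurableC; apply: countable_bigcupT_measurable; first exact: countableP.
    by move=> v; exact: measurable_eta_preimage.
  apply/eqP; rewrite eq_le measure_ge0 andbT.
  apply: (le_trans (measureU2 _ (mC _ _) (mC _ _))).
  by rewrite [X in (X + _)%E]eta_range// [X in (_ + X)%E]eta_range// adde0.
- by move=> v; rewrite mulr_ge0 ?srmass_ge0.
(* The joined list has no duplicates because the two positions differ, and the test [z.1 == (i, j)]
   selects the matching component of the outcome pair. *)
- move=> a; have := @independent_seq ([seq (i, j, l) | l <- enum 'I_N] ++ [seq (i', j', l) | l <- enum 'I_N])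
    (fun z => if z.1 == (i, j) then (a z.2).1 else (a z.2).2).
  rewrite big_cat /= 2!big_map !big_enum /= eqxx eq_sym (negbTE xy) -big_split /= => <-; last 2 first.
  + have inj (i0 j0 : 'I_n) : injective (fun l : 'I_N => (i0, j0, l)) by move=> ? ? [].
    rewrite cat_uniq (map_inj_uniq (inj i j)) (map_inj_uniq (inj i' j')).
    rewrite enum_uniq andbT /=.
    apply/hasPn => _ /mapP[l _ ->]; apply/mapP => -[l' _ [ei ej _]].
    by move: xy; rewrite ei ej eqxx.
  + by move=> z; rewrite mem_cat => /orP[] /mapP[l _ ->].
  congr (P _); apply/seteqP; split => w /= h.
    move=> z; rewrite /= mem_cat => /orP[] /mapP[l _ ->] /=; have [h1 h2] := h l I.
      by rewrite eqxx.
    by rewrite eq_sym (negbTE xy).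
  move=> l _; split.
    have := h (i, j, l); rewrite /= eqxx mem_cat map_f ?mem_enum//; exact.
  have := h (i', j', l); rewrite /= eq_sym (negbTE xy) mem_cat map_f ?mem_enum ?orbT//; exact.
- by apply: measurable_sum => l; exact: measurable_funM.
- by move=> w a ha; apply: eq_bigr => l _; have [-> ->] := ha l.
- exact: lam0.
- exact: mgf_product.
- rewrite -[in leRHS](sqrrN (b / (8 * p))); apply: mgf_product; rewrite ?normrN//.
rewrite lee_fin ler_pM2l// ler_expR le_eqVlt; apply/orP; left; apply/eqP; field.
by rewrite gt_eqF.
Qed.

End SparseRademacherLaw.

(** * Union bounds for finite maxima and for intersections of events *)

Section UnionBound.
Context {R : realType} {d : measure_display} {T : measurableType d}.
Variable P : probability T R.

(** The maximum exceeds [b] only if some term does, since [0 <= b] rules out the default 0; counting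
    all of [I] bounds the number of terms. *)
Lemma bigmax_tail (I : finType) (Q : pred I) (F : I -> T -> R) (b r : R) :
  0 <= b -> 0 <= r ->
  (forall i, measurable [set w | F i w <= b]) ->
  (forall i, Q i -> (P [set w | b < F i w]%R <= r%:E)%E) ->
  let E := [set w | \big[Num.max/0]_(i | Q i) F i w <= b] in
  measurable E /\ ((1 - #|I|%:R * r)%R%:E <= P E)%E.
Proof.
move=> b0 r0 mF Fr E.
have gtE i : [set w | b < F i w] = ~` [set w | F i w <= b].
  by apply/seteqP; split => w /=; rewrite ltNge => /negP.
have mgt i : measurable [set w | b < F i w] by rewrite gtE; exact: measurableC.
have EE : E = ~` \big[setU/set0]_(i | Q i) [set w | b < F i w].
  apply/seteqP; split => w; rewrite -bigcup_seq_cond /E /=.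
    move=> /bigmax_leP[_ h] [i /= /andP[_ Qi]]; rewrite ltNge; exact/negP/negPn/h.
  move=> h; apply/bigmax_leP; split => // i Qi; rewrite leNgt; apply/negP => bi.
  by apply: h; exists i => //=; rewrite mem_index_enum.
have mU : measurable (\big[setU/set0]_(i | Q i) [set w | b < F i w]).
  exact: bigsetU_measurable.
split; first by rewrite EE; exact: measurableC.
rewrite EE probability_setC// EFinB leeB//.
apply: (le_trans (probability_bigsetU_le P _ _ _)) => //.
apply: (@le_trans _ _ (\sum_(i | Q i) r%:E)%E); first exact: lee_sum.
rewrite sumEFin lee_fin sumr_const -[leLHS]mulr_natl ler_wpM2r// ler_nat.
exact: max_card.
Qed.

Lemma probability_setI_ge (A B : set T) (a b : R) :
  measurable A -> measurable B ->
  ((1 - a)%:E <= P A)%E -> ((1 - b)%:E <= P B)%E ->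
  ((1 - (a + b))%:E <= P (A `&` B))%E.
Proof.
move=> mA mB PA PB.
have hC (C : set T) (c : R) : measurable C -> ((1 - c)%:E <= P C)%E -> (P (~` C) <= c%:E)%E.
  move=> mCC; rewrite probability_setC// -(@fineK _ (P C)); last first.
    by rewrite ge0_fin_numE// (le_lt_trans (probability_le1 P mCC))// ltry.
  by rewrite -EFinB !lee_fin => ?; lra.
rewrite -[A `&` B]setCK setCI probability_setC; last first.
  by apply: measurableU; exact: measurableC.
rewrite EFinB leeB// EFinD.
apply: (le_trans (measureU2 _ (measurableC mA) (measurableC mB))).
by apply: leeD; apply: hC.
Qed.

End UnionBound.

(** Where the estimate fails, which happens for finitely many [n] only, the error is set to 1 and
    the claim becomes nonnegativity of the measure. *)
Lemma whp_near {R : realType} (d : nat -> measure_display)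
    (T : forall n, measurableType (d n)) (P : forall n, probability (T n) R)
    (E : forall n, set (T n)) (k : R) :
  (\forall n \near \oo, ((1 - k * n%:R ^- 2)%:E <= P n (E n))%E) -> whp P E.
Proof.
move=> PE.
exists (fun n => if `[< (1 - k * n%:R ^- 2)%:E <= P n (E n) >]%E
                 then k * n%:R ^- 2 else 1).
  apply/eqO_exP; exists (`|k| + 1); first by rewrite ltr_wpDl.
  near=> n; rewrite ifT; last by apply/asboolP; near: n.
  by rewrite normrM ler_wpM2r// lerDl.
move=> n; case: asboolP => // _.
by rewrite subrr measure_ge0.
Unshelve. all: by end_near. Qed.

(** * Growth of powers against constants and the logarithm *)

Section Asymptotics.
Context {R : realType}.

Lemma near_powR_ge (s K : R) : 0 < s -> \forall n \near \oo, K <= n%:R `^ s.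
Proof.
move=> s0; near=> n.
have [K0|K0] := leP K 0; first by rewrite (le_trans K0)// powR_ge0.
have : K `^ s^-1 <= n%:R by near: n; exact: nbhs_infty_ger.
move=> /(ge0_ler_powR (ltW s0)); rewrite !nnegrE powR_ge0 ler0n => /(_ isT isT).
by rewrite -powRrM mulVf ?gt_eqF// powRr1// ltW.
Unshelve. all: by end_near. Qed.

Lemma near_ln_le_powR (s e : R) : 0 < s -> 0 < e ->
  \forall n \near \oo, ln (n%:R : R) <= e * n%:R `^ s.
Proof.
move=> s0 e0; have s20 : 0 < s / 2 by rewrite divr_gt0.
near=> n.
have n0 : 0 < n%:R :> R by near: n; exact: nbhs_infty_gtr.
have x0 : 0 < n%:R `^ (s / 2) :> R by exact: powR_gt0.
have -> : ln (n%:R : R) = (s / 2)^-1 * ln (n%:R `^ (s / 2)).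
  by rewrite ln_powR mulKf ?gt_eqF.
rewrite [s in leRHS]splitr powRD; last by rewrite (gt_eqF n0) implybT.
have : ln (n%:R `^ (s / 2)) <= n%:R `^ (s / 2) :> R.
  rewrite -[leRHS]lnK ?posrE//; apply: le_trans (expR_ge1Dx _).
  by rewrite lerDr.
have : (e * (s / 2))^-1 <= n%:R `^ (s / 2).
  by near: n; exact: near_powR_ge.
rewrite -[_^-1]div1r ler_pdivrMr ?mulr_gt0// => h1 h2.
rewrite mulrC ler_pdivrMr//; apply: (le_trans h2).
by have := ler_wpM2l (ltW x0) h1; lra.
Unshelve. all: by end_near. Qed.

End Asymptotics.

(** * Almost sure bound on the operator norm *)

Section OpnormTail.
Context {R : realType} {d : measure_display} {T : measurableType d}.
Variables (P : probability T R) (p : R) (n N : nat).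
Variable eta : 'I_n * 'I_n * 'I_N -> {RV P >-> R}.
Hypothesis iid : iid_sparse_rademacher p eta.

Lemma norm_srval (v : 'I_3) : `|srval v : R| <= 1.
Proof. by rewrite /srval ler_norml; case: v => [[|[|[|//]]] ?] /=; lra. Qed.

Lemma opnorm_tail l (b : R) : b = n%:R * (Num.sqrt (2 * N%:R * p))^-1 ->
  (P [set w | b < opnorm (Qmx p (fun x => eta x w) l)]%R <= 0)%E.
Proof.
move=> bE.
have b0 : 0 <= b by rewrite bE mulr_ge0 ?invr_ge0 ?sqrtr_ge0.
(* The null event that some variable of the [l]-th matrix leaves the three atoms; off it the
   entrywise bound applies. *)
pose G := \big[setU/set0]_(x : 'I_n * 'I_n | (x.1 <= x.2)%N)
  ~` (\bigcup_v eta (x, l) @^-1` [set srval v]).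
have mU x : measurable (~` (\bigcup_v eta (x, l) @^-1` [set srval v])).
  apply: measurableC; apply: countable_bigcupT_measurable; first exact: countableP.
  by move=> v; exact: measurable_eta_preimage.
have mG : measurable G by apply: bigsetU_measurable.
have mB : measurable [set w | b < opnorm (Qmx p (fun x => eta x w) l)].
  rewrite (_ : mkset _ = ~` [set w | opnorm (Qmx p (fun x => eta x w) l) <= b]).
    apply: measurableC; apply: measurable_opnorm_le => // i j.
    exact: measurable_Qmx.
  by apply/seteqP; split => w /=; rewrite ltNge => /negP.
apply: (@le_trans _ _ (P G)); last first.
  apply: (le_trans (probability_bigsetU_le P _ _ _)) => //.
  by rewrite big1// => x xD; exact: (eta_range iid).
apply: le_measure; rewrite ?inE// => w /=; rewrite ltNge => /negP nb.
apply: contrapT => Gw; apply: nb.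
have eta_le (i j : 'I_n) : (i <= j)%N -> `|eta (i, j, l) w| <= 1.
  move=> ij; apply: contrapT => h; apply: Gw; rewrite /G -bigcup_seq_cond.
  exists (i, j); first by rewrite /= mem_index_enum.
  by move=> [v _ /= ev]; apply: h; rewrite ev norm_srval.
apply/(opnorm_leP _ b0) => v; rewrite bE; apply: l2norm_mulmx_le_entries.
  by rewrite invr_ge0 sqrtr_ge0.
move=> i j; rewrite mxE normrM normfV (ger0_norm (sqrtr_ge0 _)).
rewrite ler_piMl ?invr_ge0 ?sqrtr_ge0//.
(* Below the diagonal the entry is read at the transposed position. *)
by have [/eta_le//|/ltnW/eta_le//] := leqP i j.
Qed.

End OpnormTail.

(** * High-probability bounds along the sequence of models *)

Section Concentration.
Context {R : realType} {d : nat -> measure_display}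
  {T : forall n, measurableType (d n)}.
Variables (eps : R) (P : forall n, probability (T n) R).
Variables (N : nat -> nat) (p : nat -> R).
Variable eta : forall n, 'I_n * 'I_n * 'I_(N n) -> {RV (P n) >-> R}.
Hypotheses (eps_gt0 : 0 < eps) (N_ge1 : forall n, (1 <= N n)%N).
Hypothesis p_bounds : forall n, 0 < p n <= 1 / 2.
Hypothesis iid : forall n, iid_sparse_rademacher (p n) (@eta n).

Let Q n (w : T n) := Qmx (p n) (fun x => @eta n x w).

Let powR_2D (n : nat) : (0 < n)%N ->
  n%:R `^ (2 + 2 * eps) = n%:R ^+ 2 * (n%:R `^ eps) ^+ 2 :> R.
Proof.
move=> n0; rewrite powRD; last by rewrite pnatr_eq0 -lt0n n0 implybT.
by rewrite powR_mulrn// [2 * eps]mulrC powRrM powR_mulrn ?powR_ge0.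
Qed.

(** The two families fail with probability at most [2 * n%:R ^- 2] each, which gives the constant 4.
    The factor 48 serves both: as [8 * 6] for the products and as [16 * 3] for the squares. *)
Lemma dev_whp (c : R) : 0 < c ->
  (\forall n \near \oo, c <= n%:R * p n) ->
  (\forall n \near \oo,
     48 * (n%:R `^ (2 + 2 * eps)) * ln (n%:R : R) <= (N n)%:R) ->
  whp P (fun n => [set w | diag_dev (Q w) <= 1 / (ln (n%:R : R)) ^+ 2 /\
                           offdiag_dev (Q w) <= 1 / (n%:R : R) `^ (1 + eps)]).
Proof.
move=> c0 np_ge N_ge; apply: (@whp_near _ _ _ _ _ 4).
pose e := Num.min 1 (3 * c).
have e0 : 0 < e by rewrite lt_min ltr01 mulr_gt0.
near=> n.
have n0 : (0 < n)%N by near: n; exact: nbhs_infty_gt.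
have nR0 : 0 < n%:R :> R by rewrite ltr0n.
have [p0 p1] := andP (p_bounds n).
have N0 : 0 < (N n)%:R :> R by rewrite ltr0n.
have cnp : c <= n%:R * p n by near: n.
have NC : 48 * (n%:R `^ (2 + 2 * eps)) * ln (n%:R : R) <= (N n)%:R by near: n.
rewrite powR_2D// in NC.
have L1 : 1 <= ln (n%:R : R).
  have e_n : expR 1 <= n%:R :> R by near: n; exact: nbhs_infty_ger.
  by rewrite -ler_expR lnK.
have nL : expR (ln (n%:R : R)) = n%:R by rewrite lnK.
have Le : ln n%:R <= e * n%:R `^ 4^-1 by near: n; exact: near_ln_le_powR.
set L := ln _ in NC L1 nL Le *.
have [n1eps1 n1eps2] : n%:R `^ (1 + eps) = n%:R * n%:R `^ eps :> R /\ 1 <= n%:R `^ eps :> R.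
  split; last by near: n; exact: near_powR_ge.
  by rewrite powRD ?pnatr_eq0 -?lt0n ?n0 ?implybT// powRr1.
(* Ensures that [b = 1 / (n * Y)] meets the condition [b <= 4 * p] of [offdiag_tail], as
   [1 <= 4 * c * Y <= 4 * n * p * Y]. *)
have Y_ge : (4 * c)^-1 <= n%:R `^ eps by near: n; exact: near_powR_ge.
set Y := _ `^ eps in NC n1eps1 n1eps2 Y_ge.
pose D1 : set (T n) := [set w | diag_dev (Q w) <= 1 / L ^+ 2].
pose D2 : set (T n) := [set w | offdiag_dev (Q w) <= 1 / n%:R `^ (1 + eps)].
pose L4 := L ^+ 4.
have L4n : L4 <= 3 * c * n%:R.
  apply: (@le_trans _ _ ((e * n%:R `^ 4^-1) ^+ 4)).
    by rewrite lerXn2r ?nnegrE ?mulr_ge0 ?powR_ge0 ?(ltW e0)// (le_trans ler01).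
  rewrite exprMn -(powR_mulrn 4 (powR_ge0 _ _)) -powRrM mulVf ?pnatr_eq0// powRr1//.
  rewrite ler_wpM2r//; apply: (@le_trans _ _ e); last by rewrite ge_min lexx orbT.
  by rewrite -[leRHS]expr1 ler_wiXn2l ?(ltW e0)// ge_min lexx.
have [mD1 PD1] : measurable D1 /\ ((1 - 2 * n%:R ^- 2)%:E <= P n D1)%E.
  pose r : R := 2 * expR (- (4 * L)).
  have rE : r = 2 * n%:R^-1 ^+ 4 by rewrite /r -mulrN expRM_natl expRN nL.
  have [||||mD PD] := @bigmax_tail _ _ _ (P n) ('I_n * 'I_n)%type
    (fun x => (x.1 <= x.2)%N)
    (fun x w => `|\sum_(l < N n) Q w l x.1 x.2 ^+ 2 - 1|) (1 / L ^+ 2) r.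
  - by rewrite divr_ge0// sqr_ge0.
  - by rewrite mulr_ge0// expR_ge0.
  - move=> x; rewrite -[X in measurable X]setTI; apply: measurable_fun_le => //.
    apply: measurableT_comp => //; apply: measurable_funB; last exact: measurable_cst.
    by apply: measurable_sum => l; apply: measurable_funX; exact: measurable_Qmx.
  - move=> x xD; apply: (le_trans (diag_tail (iid n) (p_bounds n) (N_ge1 n) xD _)).
      by rewrite divr_ge0 ?sqr_ge0//= ler_pdivrMr; nra.
    (* The claim amounts to [16 * L ^+ 5 <= N * p], which follows from [48 * n * L * c <= N * p] and
       [L4n]. *)
    rewrite lee_fin /r ler_pM2l// ler_expR lerN2 ler_pdivlMr//.
    have -> : (N n)%:R * p n * (1 / L ^+ 2) ^+ 2 = (N n)%:R * p n / L4.
      by rewrite /L4; field; rewrite gt_eqF// (lt_le_trans ltr01).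
    rewrite ler_pdivlMr ?exprn_gt0 ?(lt_le_trans ltr01)//.
    have L0 : 0 <= L by exact: le_trans ler01 L1.
    have Y2 : 1 <= Y ^+ 2 by rewrite exprn_ege1.
    have NL : 48 * n%:R ^+ 2 * L <= (N n)%:R.
      by apply: le_trans NC; rewrite ler_wpM2r// mulrA ler_peMr// mulr_ge0// sqr_ge0.
    have Nnp : 48 * n%:R * L * c <= (N n)%:R * p n.
      rewrite -(ler_pM2l nR0).
      apply: (@le_trans _ _ (48 * n%:R ^+ 2 * L * c)); first by rewrite expr2 -!mulrA; lra.
      apply: (@le_trans _ _ ((N n)%:R * (n%:R * p n))); last by rewrite mulrCA.
      by apply: ler_pM => //; rewrite ?mulr_ge0 ?sqr_ge0// ltW.
    apply: le_trans Nnp; have := ler_wpM2l L0 L4n; lra.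
  split => //; apply: le_trans PD; rewrite lee_fin rE card_prod card_ord natrM.
  by rewrite le_eqVlt; apply/orP; left; apply/eqP; field; rewrite gt_eqF.
have [mD2 PD2] : measurable D2 /\ ((1 - 2 * n%:R ^- 2)%:E <= P n D2)%E.
  pose r : R := 2 * expR (- (6 * L)).
  have rE : r = 2 * n%:R^-1 ^+ 6 by rewrite /r -mulrN expRM_natl expRN nL.
  have [||||mD PD] := @bigmax_tail _ _ _ (P n)
    (('I_n * 'I_n) * ('I_n * 'I_n))%type
    (fun xy => [&& (xy.1.1 <= xy.1.2)%N, (xy.2.1 <= xy.2.2)%N & xy.1 != xy.2])
    (fun xy w => `|\sum_(l < N n) Q w l xy.1.1 xy.1.2 * Q w l xy.2.1 xy.2.2|)
    (1 / n%:R `^ (1 + eps)) r.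
  - by rewrite divr_ge0// powR_ge0.
  - by rewrite mulr_ge0// expR_ge0.
  - move=> x; rewrite -[X in measurable X]setTI; apply: measurable_fun_le => //.
    apply: measurableT_comp => //; apply: measurable_sum => l.
    by apply: measurable_funM; exact: measurable_Qmx.
  - move=> [x y] /= /and3P[xD yD xy].
    apply: (le_trans (offdiag_tail (iid n) (p_bounds n) (N_ge1 n) xD yD xy _)).
      rewrite divr_ge0 ?powR_ge0//= ler_pdivrMr ?powR_gt0// n1eps1.
      move: Y_ge; rewrite -[_^-1]div1r ler_pdivrMr ?mulr_gt0// => /le_trans; apply.
      have Y0 : 0 <= Y by exact: powR_ge0.
      have := ler_wpM2l Y0 cnp; lra.
    (* The claim [6 * L <= N * b ^+ 2 / 8] with [b = 1 / (n * Y)] is exactly [NC]. *)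
    rewrite lee_fin /r ler_pM2l// ler_expR lerN2 ler_pdivlMr// n1eps1.
    rewrite div1r exprVn ler_pdivlMr ?exprn_gt0 ?mulr_gt0 ?powR_gt0// exprMn.
    by apply: le_trans NC; lra.
  split => //; apply: le_trans PD; rewrite lee_fin rE !card_prod card_ord !natrM.
  by rewrite le_eqVlt; apply/orP; left; apply/eqP; field; rewrite gt_eqF.
have := probability_setI_ge mD1 mD2 PD1 PD2.
by rewrite -mulrDl -natrD.
Unshelve. all: by end_near. Qed.

(** Each single tail is null, so the union over [N n] matrices costs nothing however large [N n] is,
    and the error constant is 0. *)
Lemma max_opnorm_whp :
  whp P (fun n => [set w | max_opnorm (Q w) <= n%:R * (Num.sqrt (2 * (N n)%:R * p n))^-1]).
Proof.
apply: (@whp_near _ _ _ _ _ 0); near=> n.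
set b := _ * _^-1.
have [|//|||_] := @bigmax_tail _ _ _ (P n) 'I_(N n) xpredT
  (fun l w => opnorm (Q w l)) b 0.
- by rewrite /b mulr_ge0 ?invr_ge0 ?sqrtr_ge0.
- move=> l; apply: measurable_opnorm_le => [|i j].
    by rewrite /b mulr_ge0 ?invr_ge0 ?sqrtr_ge0.
  exact: measurable_Qmx.
- by move=> l _; exact: (opnorm_tail (iid n)).
by rewrite mulr0 mul0r.
Unshelve. all: by end_near. Qed.

(** After squaring, the claim reads [n^2 * L^4 <= e^2 * n * (2 * N * p)]. Multiplying the two growth
    hypotheses gives [n^2 * Y^2 * L^2 <= N * n * p], and eventually [L <= e * Y]. *)
Lemma opnorm_bound_littleo :
  (\forall n \near \oo, 1 * ln (n%:R : R) <= n%:R * p n) ->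
  (\forall n \near \oo,
     1 * (n%:R `^ (2 + 2 * eps)) * ln (n%:R : R) <= (N n)%:R) ->
  (fun n => n%:R * (Num.sqrt (2 * (N n)%:R * p n))^-1) =o_\oo
  (fun n => Num.sqrt (n%:R : R) / (ln (n%:R : R)) ^+ 2).
Proof.
move=> np_ge N_ge; apply/eqoP => e e0; near=> n.
have n0 : (0 < n)%N by near: n; exact: nbhs_infty_gt.
have nR0 : 0 < n%:R :> R by rewrite ltr0n.
have [p0 p1] := andP (p_bounds n).
have N0 : 0 < (N n)%:R :> R by rewrite ltr0n.
have Lnp : 1 * ln (n%:R : R) <= n%:R * p n by near: n.
have NC : 1 * (n%:R `^ (2 + 2 * eps)) * ln (n%:R : R) <= (N n)%:R by near: n.
rewrite powR_2D// mul1r in NC; rewrite mul1r in Lnp.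
have L1 : 1 <= ln (n%:R : R).
  have e_n : expR 1 <= n%:R :> R by near: n; exact: nbhs_infty_ger.
  by rewrite -ler_expR lnK.
have LY : ln (n%:R : R) <= e * n%:R `^ eps by near: n; exact: near_ln_le_powR.
move: (ln _) (_ `^ eps) NC Lnp L1 LY => L Y NC Lnp L1 LY.
have L0 : 0 <= L by exact: le_trans ler01 L1.
have s0 : 0 < 2 * (N n)%:R * p n by rewrite !mulr_gt0.
rewrite !ger0_norm; last 2 first.
- by rewrite divr_ge0 ?sqr_ge0 ?sqrtr_ge0.
- by rewrite mulr_ge0 ?invr_ge0 ?sqrtr_ge0.
rewrite ler_pdivrMr ?sqrtr_gt0// mulrA mulrAC ler_pdivlMr ?exprn_gt0//; last first.
  exact: lt_le_trans L1.
rewrite -ler_sqr ?nnegrE ?mulr_ge0 ?sqrtr_ge0 ?sqr_ge0 ?(ltW e0)//.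
rewrite !exprMn !sqr_sqrtr ?(ltW s0)//.
have N2 : n%:R ^+ 2 * Y ^+ 2 * L * L <= (N n)%:R * (n%:R * p n).
  apply: ler_pM => //.
  exact: (mulr_ge0 (mulr_ge0 (sqr_ge0 _) (sqr_ge0 _)) L0).
have LY2 : L ^+ 2 <= e ^+ 2 * Y ^+ 2.
  by rewrite -exprMn ler_sqr// nnegrE (le_trans L0 LY).
apply: (@le_trans _ _ (e ^+ 2 * (n%:R ^+ 2 * Y ^+ 2 * L * L))).
  have -> : e ^+ 2 * (n%:R ^+ 2 * Y ^+ 2 * L * L) = n%:R ^+ 2 * (e ^+ 2 * Y ^+ 2 * L ^+ 2) by ring.
  rewrite ler_pM2l ?exprn_gt0//.
  by rewrite ler_wpM2r// sqr_ge0.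
have := ler_wpM2l (sqr_ge0 e) N2; move=> /le_trans; apply.
have -> : e ^+ 2 * n%:R * (2 * (N n)%:R * p n) = 2 * (e ^+ 2 * ((N n)%:R * (n%:R * p n))) by ring.
by rewrite ler_peMl ?ler1n// mulr_ge0 ?sqr_ge0// ltW// !mulr_gt0.
Unshelve. all: by end_near. Qed.

End Concentration.

(** * Choice of the constants and of the bounding sequences *)

Theorem proposition2 (R : realType) (eps : R) (eps_gt0 : 0 < eps) :
  (exists C : R, 0 < C /\
    forall (N : nat -> nat) (p : nat -> R)
      (d : nat -> measure_display) (T : forall n, measurableType (d n))
      (P : forall n, probability (T n) R)
      (eta : forall n, 'I_n * 'I_n * 'I_(N n) -> {RV (P n) >-> R}),
    (forall n, (1 <= N n)%N) ->
    (forall n, 0 < p n <= 1 / 2) ->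
    (forall n, iid_sparse_rademacher (p n) (@eta n)) ->
    p @ \oo --> (0 : R) ->
    (exists2 c : R, 0 < c & \forall n \near \oo, c <= n%:R * p n) ->
    (\forall n \near \oo,
       C * (n%:R `^ (2 + 2 * eps)) * ln (n%:R : R) <= (N n)%:R) ->
    let Q n (w : T n) := Qmx (p n) (fun x => @eta n x w) in
    exists b1 b2 : nat -> R,
      [/\ b1 =O_\oo (fun n => 1 / (ln (n%:R : R)) ^+ 2),
          b2 =O_\oo (fun n => 1 / ((n%:R : R) `^ (1 + eps))) &
          whp P (fun n => [set w | diag_dev (Q n w) <= b1 n /\
                                   offdiag_dev (Q n w) <= b2 n])]) /\
  (exists C0 C1 : R, 1 <= C0 /\ 0 < C1 /\
    forall (N : nat -> nat) (p : nat -> R)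
      (d : nat -> measure_display) (T : forall n, measurableType (d n))
      (P : forall n, probability (T n) R)
      (eta : forall n, 'I_n * 'I_n * 'I_(N n) -> {RV (P n) >-> R}),
    (forall n, (1 <= N n)%N) ->
    (forall n, 0 < p n <= 1 / 2) ->
    (forall n, iid_sparse_rademacher (p n) (@eta n)) ->
    (fun n => p n / (1 / (ln (n%:R : R)) ^+ 4)) @ \oo --> (0 : R) ->
    (\forall n \near \oo, C0 * ln (n%:R : R) <= n%:R * p n) ->
    (\forall n \near \oo,
       C1 * (n%:R `^ (2 + 2 * eps)) * ln (n%:R : R) <= (N n)%:R) ->
    let Q n (w : T n) := Qmx (p n) (fun x => @eta n x w) in
    exists2 b : nat -> R,
      b =o_\oo (fun n => Num.sqrt (n%:R : R) / (ln (n%:R : R)) ^+ 2) &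
      whp P (fun n => [set w | max_opnorm (Q n w) <= b n])).
Proof.
have eqO_refl (f : nat -> R) : f =O_\oo f.
  by apply/eqO_exP; exists 1 => //; near=> n; rewrite mul1r.
split.
  (* The bounding sequences are the comparison functions themselves, with implied constant 1. *)
  exists 48; split=> // N p d T P eta N1 pb iid _ [c c0 np] NC Q.
  exists (fun n => 1 / (ln (n%:R : R)) ^+ 2), (fun n => 1 / (n%:R : R) `^ (1 + eps)).
  by split => //; exact: dev_whp np NC.
exists 1, 1; do 2!split=> //; move=> N p d T P eta N1 pb iid _ np NC Q.
exists (fun n => n%:R * (Num.sqrt (2 * (N n)%:R * p n))^-1).
  exact: opnorm_bound_littleo np NC.
exact: max_opnorm_whp.
Unshelve. all: by end_near. Qed.
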